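(* Let $\mathcal{T}$ be a plane full binary tree whose leaves, ordered from left to right, are identified with $\mathcal{L}=\{1,\ldots,n\}$. Then for every $\ell\in\{1,\ldots,n\}$, the set $\{1,\ldots,\ell\}$ is a union of at most $1+h_\ell$ sets of the form $D_{\mathcal{T}}(v)$ with $v$ a vertex of $\mathcal{T}$.
   Context: A full binary tree is a finite rooted tree in which every vertex has either exactly two children (a node) or none (a leaf). A plane tree additionally specifies, for each node, which child is left and which is right. Each vertex $v$ is encoded by the $0/1$-word recording the left (0) and right (1) steps on the path from the root to $v$ (the root has the empty word); the left-to-right order of the leaves is the lexicographic order of their words. $D_{\mathcal{T}}(v)$ denotes the set of leaves descending from $v$ (a leaf descends from itself). The height $h_v$ of a vertex $v$ is the number of 1s occurring before the last 0 in its word (and $h_v=0$ if the word contains no 0); $h_\ell$ is the height of the leaf $\ell$. *)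

(* Defs.v *)
From mathcomp Require Import all_boot all_order.

Set Implicit Arguments.
Unset Strict Implicit.
Unset Printing Implicit Defensive.

Import Order.TTheory.

(* [Node l r] carries its left subtree [l] and its right subtree [r]. *)
Inductive plane_tree : Type :=
| Leaf
| Node of plane_tree & plane_tree.

(* A left step (0) is [false], a right step (1) is [true]. *)
Definition word := seq bool.

Fixpoint vertices (t : plane_tree) : seq word :=
  match t with
  | Leaf => [:: [::]]
  | Node l r =>
      [::] :: map (cons false) (vertices l) ++ map (cons true) (vertices r)
  end.

(* The leaves from left to right; see [mem_leaves] and [leaves_lexi_sorted]. *)
Fixpoint leaves (t : plane_tree) : seq word :=
  match t with
  | Leaf => [:: [::]]
  | Node l r => map (cons false) (leaves l) ++ map (cons true) (leaves r)
  end.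

Lemma mem_cons_map (b c : bool) (w : word) (s : seq word) :
  (b :: w \in map (cons c) s) = (b == c) && (w \in s).
Proof.
apply/mapP/andP => [[v vs [-> ->]]|[/eqP-> ws]]; first by rewrite eqxx.
by exists w.
Qed.

Lemma nil_map_cons (c : bool) (s : seq word) :
  ([::] \in map (cons c) s) = false.
Proof. by apply/mapP => -[]. Qed.

Lemma nil_vertices t : [::] \in vertices t.
Proof. by case: t => *; rewrite ?inE. Qed.

Lemma mem_leaves t w :
  (w \in leaves t) =
  [&& w \in vertices t, rcons w false \notin vertices t
    & rcons w true \notin vertices t].
Proof.
elim: t w => [|l IHl r IHr] [|[] w] //=;
  rewrite !(mem_cat, inE, mem_cons_map, nil_map_cons, nil_vertices) //= ?orbF.
exact: IHl.
Qed.

Lemma leaves_lexi_sorted t : sorted <%O (leaves t : seq (seqlexi bool)).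
Proof.
rewrite (sorted_pairwise lt_trans); elim: t => //= l IHl r IHr.
rewrite pairwise_cat !pairwise_map; apply/and3P; split.
- by apply/allrelP => _ _ /mapP[u _ ->] /mapP[v _ ->].
- by apply: sub_pairwise IHl => u v; rewrite /= ltxi_cons lexx.
- by apply: sub_pairwise IHr => u v; rewrite /= ltxi_cons lexx.
Qed.

(* The leaves 1, ..., n are indexed by ['I_n] = {0, ..., n-1}, so that
   [i : 'I_n] stands for the leaf i + 1. *)
Definition nleaves (t : plane_tree) : nat := size (leaves t).

Definition leaf (t : plane_tree) (i : 'I_(nleaves t)) : word :=
  nth [::] (leaves t) i.

Definition descendant_leaves (t : plane_tree) (v : word) :
    {set 'I_(nleaves t)} :=
  [set i | prefix v (leaf i)].

(* [rev w] is cut at its first [false], that is, [w] is cut at its last one;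
   nothing remains when [w] contains no [false]. *)
Definition height (w : word) : nat :=
  count_mem true (drop (index false (rev w)) (rev w)).

(* Main.v *)
Require Import Defs.
From mathcomp Require Import all_boot all_order.

(** Induction on the tree. If the leaf lies in the left subtree, the cover of
    that subtree is kept. If it lies in the right subtree and is not the last
    leaf, the cover of the right subtree is completed by the whole left subtree,
    and the height grows by one. The last leaf is the only one whose word
    contains no 0: it has height 0, and the root alone covers everything. *)

(** After reversal [b] comes last, so the cut does not move when [w] contains a 0. Otherwise at most
    a single 0 remains after it. *)
Lemma height_cons (b : bool) (w : word) :
  height (b :: w) = (b && (false \in w)) + height w.
Proof.
rewrite /height rev_cons -cats1 index_cat mem_rev.
have [w0|w0] := boolP (false \in w); last first.
  rewrite (memNindex (s := rev w)) ?mem_rev // drop_size drop_cat.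
  by rewrite ltnNge leq_addr addKn; case: b.
rewrite drop_cat index_mem mem_rev w0 count_cat addnC.
by case: b.
Qed.

Lemma nth_leaves_Node (l r : plane_tree) (i : nat) :
  i < size (leaves (Node l r)) ->
  nth [::] (leaves (Node l r)) i =
    if i < size (leaves l) then false :: nth [::] (leaves l) i
    else true :: nth [::] (leaves r) (i - size (leaves l)).
Proof.
rewrite /= size_cat !size_map nth_cat size_map => ilt.
by case: ltnP => il; rewrite (nth_map [::]) // ltn_subLR.
Qed.

(** A path that only steps right ends at the rightmost leaf. *)
Lemma leaf_without_false_last (t : plane_tree) (k : nat) :
  k < size (leaves t) -> false \notin nth [::] (leaves t) k ->
  k.+1 = size (leaves t).
Proof.
elim: t k => [|l _ r IHr] k kt; first by case: k kt.
rewrite nth_leaves_Node //; case: ltnP => [//|lk].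
move: kt; rewrite /= size_cat !size_map => kt.
rewrite inE => /IHr <-; last by rewrite ltn_subLR.
by rewrite addnS subnKC.
Qed.

Lemma has_prefix_map_cons (b c : bool) (s : seq word) (w : word) :
  has (fun v => prefix v (c :: w)) (map (cons b) s) = (b == c) && has (fun v => prefix v w) s.
Proof.
rewrite has_map; have [->|bc] := eqVneq b c.
  by apply: eq_has => v /=; rewrite eqxx.
by apply/hasPn => v _ /=; rewrite (negbTE bc).
Qed.

(** Words and natural indices replace sets over ['I_(nleaves t)], a type that changes when the
    induction passes to a subtree. *)
Lemma initial_leaves_cover (t : plane_tree) (k : nat) :
  k < size (leaves t) ->
  exists s : seq word,
    [/\ size s <= 1 + height (nth [::] (leaves t) k),
        {subset s <= vertices t}
      & forall i, i < size (leaves t) ->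
          has (fun v => prefix v (nth [::] (leaves t) i)) s = (i <= k)].
Proof.
elim: t k => [|l IHl r IHr] k kt.
  by exists [:: [::]]; split=> // -[|i] //=; rewrite ?leq0n.
have szt : size (leaves (Node l r)) = size (leaves l) + size (leaves r).
  by rewrite /= size_cat !size_map.
rewrite nth_leaves_Node //.
case: ltnP => [kl|lk]; rewrite height_cons.
  have [s [szs sV sP]] := IHl k kl.
  exists (map (cons false) s); split; first by rewrite size_map.
    by move=> _ /mapP[v /sV vl ->]; rewrite !inE mem_cat mem_cons_map vl.
  move=> i it; rewrite nth_leaves_Node //; case: ltnP => il.
    by rewrite has_prefix_map_cons sP.
  by rewrite has_prefix_map_cons leqNgt (leq_trans kl il).
have kr : k - size (leaves l) < size (leaves r).
  by rewrite ltn_subLR -?szt.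
(* The leading 1 raises the height only if a 0 follows; otherwise there is no room for one more
   vertex. *)
have [w0|w0] := boolP (false \in _); last first.
  have kE := leaf_without_false_last _ _ kr w0.
  exists [:: [::]]; split=> //.
    by move=> v; rewrite inE => /eqP->; rewrite inE.
  move=> i; rewrite szt -kE addnS subnKC //.
  by rewrite ltnS => ->; case: nth.
have [s [szs sV sP]] := IHr _ kr.
(* The word [[:: false]] is the root of the left subtree; the leading 1 pays for it. *)
exists ([:: false] :: map (cons true) s); split.
- by rewrite /= size_map.
- move=> v; rewrite inE => /predU1P[->|/mapP[u /sV ur ->]].
    by rewrite inE mem_cat mem_cons_map nil_vertices.
  by rewrite !inE mem_cat !mem_cons_map ur.
move=> i it; rewrite nth_leaves_Node //; case: ltnP => il.
  by rewrite /= prefix0s (leq_trans (ltnW il) lk).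
rewrite /= has_prefix_map_cons sP ?leq_sub2rE //=.
by rewrite ltn_subLR // -szt.
Qed.

Theorem theorem4p4 (t : plane_tree) (l : 'I_(nleaves t)) :
  exists F : {set {set 'I_(nleaves t)}},
    [/\ #|F| <= 1 + height (leaf l),
        forall A, A \in F ->
          exists2 v, v \in vertices t & A = descendant_leaves t v
      & cover F = [set i : 'I_(nleaves t) | i <= l]].
Proof.
have [s [szs sV sP]] := initial_leaves_cover t l (ltn_ord l).
(* Equal sets collapse here, so the size of [s] only bounds the cardinality from above. *)
exists [set:: map (descendant_leaves t) s]; split.
- apply: leq_trans szs; rewrite cardsE -(size_map (descendant_leaves t)).
  exact: card_size.
- by move=> A; rewrite inE => /mapP[v /sV vt ->]; exists v.
apply/setP => i; rewrite inE -sP //; apply/bigcupP/hasP.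
  by case=> A; rewrite inE => /mapP[v vs ->]; rewrite inE; exists v.
case=> v vs vi; exists (descendant_leaves t v); last by rewrite inE.
by rewrite inE map_f.
Qed.
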